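(* Let $f \colon \mathbb{R}^n \to \mathbb{R}$ be a lower semi-continuous function. If $f$ is Lipschitz at infinity, then $$\mathrm{co}\, \partial f(\infty) = \partial^{\mathrm{Clarke}} f(\infty),$$ where $\mathrm{co}$ denotes the convex hull.
   Context: $\mathbb{R}^n$ carries the Euclidean norm and scalar product; $\mathbb{B}_R$ is the closed ball of radius $R$ centered at the origin. Lipschitz at infinity: $f \colon \mathbb{R}^n \to \mathbb{R}$ is Lipschitz at infinity if there exist constants $L > 0$ and $R > 0$ such that $|f(x) - f(x')| \le L\|x - x'\|$ for all $x, x' \in \mathbb{R}^n \setminus \mathbb{B}_R$. Regular normal cone: for a set $\Omega \subset \mathbb{R}^N$ and $z \in \Omega$, $\widehat{N}_\Omega(z)$ is the set of $\xi \in \mathbb{R}^N$ with $\langle \xi, z' - z\rangle \le o(\|z' - z\|)$ as $z' \to z$, $z' \in \Omega$. Limiting subdifferential at infinity: with $\mathrm{epi} f := \{(x,r) \in \mathbb{R}^n \times \mathbb{R} \mid f(x) \le r\}$, let $N_{\mathrm{epi} f}(\infty_I)$ (where $I = \{1,\dots,n\} \subset \{1,\dots,n+1\}$) be the set of all $\zeta \in \mathbb{R}^{n+1}$ for which there exist $(x_k, r_k) \in \mathrm{epi} f$ with $\|x_k\| \to \infty$ and $\zeta_k \in \widehat{N}_{\mathrm{epi} f}(x_k, r_k)$ with $\zeta_k \to \zeta$. Then $\partial f(\infty) := \{u \in \mathbb{R}^n \mid (u,-1) \in N_{\mathrm{epi} f}(\infty_I)\}$. Clarke subdifferential at infinity: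 the Clarke tangent cone $T_{\mathrm{epi} f}(\infty_I)$ of $\mathrm{epi} f$ at infinity is the set of all $v \in \mathbb{R}^{n+1}$ such that, whenever $z_k = (x_k, r_k) \in \mathrm{epi} f$ with $\|x_k\| \to \infty$ and $t_k \searrow 0$, there exists a sequence $v_k \to v$ such that $z_k + t_k v_k \in \mathrm{epi} f$ for all $k$. The Clarke normal cone at infinity is its polar, $N^{\mathrm{Clarke}}_{\mathrm{epi} f}(\infty_I) := \{\xi \in \mathbb{R}^{n+1} \mid \langle \xi, v\rangle \le 0 \text{ for all } v \in T_{\mathrm{epi} f}(\infty_I)\}$, and $\partial^{\mathrm{Clarke}} f(\infty) := \{u \in \mathbb{R}^n \mid (u,-1) \in N^{\mathrm{Clarke}}_{\mathrm{epi} f}(\infty_I)\}$. *)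

(* Defs.v *)
From HB Require Import structures.
From mathcomp Require Import all_boot all_order all_algebra.
From mathcomp Require Import all_classical all_reals all_analysis.

Set Implicit Arguments.
Unset Strict Implicit.
Unset Printing Implicit Defensive.

Import Order.TTheory GRing.Theory Num.Theory.
Import numFieldNormedType.Exports.

Local Open Scope classical_set_scope.
Local Open Scope ring_scope.

(* The library norm on ['rV[R]_n] is the sup norm, so the Euclidean structure
   is defined here. Both norms induce the same topology; hence [nbhs] and
   [_ @ \oo --> _] on row vectors have their usual Euclidean meaning. *)
Definition dot (R : realType) (n : nat) (u v : 'rV[R]_n) : R :=
  \sum_(i < n) u 0 i * v 0 i.

Definition norm2 (R : realType) (n : nat) (u : 'rV[R]_n) : R :=
  Num.sqrt (dot u u).

Definition cball2 (R : realType) (n : nat) (r : R) : set 'rV[R]_n :=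
  [set x | norm2 x <= r].

Definition lipschitz_at_infinity (R : realType) (n : nat)
    (f : 'rV[R]_n -> R) : Prop :=
  exists L r : R, [/\ 0 < L, 0 < r &
    forall x x' : 'rV[R]_n, (~` cball2 r) x -> (~` cball2 r) x' ->
      `|f x - f x'| <= L * norm2 (x - x')].

(* Only meant for [z] in [Omega]. *)
Definition regular_normal_cone (R : realType) (N : nat)
    (Omega : set 'rV[R]_N) (z : 'rV[R]_N) : set 'rV[R]_N :=
  [set xi | forall e : R, 0 < e ->
    \forall z' \near within Omega (nbhs z),
      dot xi (z' - z) <= e * norm2 (z' - z)].

(* [R^n x R] is ['rV[R]_(n + 1)]: [z] stands for the pair
   [(lsubmx z, rsubmx z 0 0)]. *)
Definition epi (R : realType) (n : nat) (f : 'rV[R]_n -> R) :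
    set 'rV[R]_(n + 1) :=
  [set z | f (lsubmx z) <= rsubmx z 0 0].

(* The first [n] coordinates tend to infinity in norm; the last one is free. *)
Definition tends_to_inftyI (R : realType) (n : nat)
    (z : nat -> 'rV[R]_(n + 1)) : Prop :=
  (fun k => norm2 (lsubmx (z k))) @ \oo --> +oo.

Definition normal_cone_infty (R : realType) (n : nat)
    (Omega : set 'rV[R]_(n + 1)) : set 'rV[R]_(n + 1) :=
  [set zeta | exists z zeta_ : nat -> 'rV[R]_(n + 1),
    [/\ forall k, Omega (z k),
        tends_to_inftyI z,
        forall k, regular_normal_cone Omega (z k) (zeta_ k) &
        zeta_ @ \oo --> zeta]].

Definition subdiff_infty (R : realType) (n : nat) (f : 'rV[R]_n -> R) :
    set 'rV[R]_n :=
  [set u | normal_cone_infty (epi f) (row_mx u (-1)%:M)].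

Definition clarke_tangent_cone_infty (R : realType) (n : nat)
    (Omega : set 'rV[R]_(n + 1)) : set 'rV[R]_(n + 1) :=
  [set v | forall (z : nat -> 'rV[R]_(n + 1)) (t : nat -> R),
    (forall k, Omega (z k)) -> tends_to_inftyI z ->
    (forall k, 0 < t k) -> t @ \oo --> (0 : R) ->
    exists2 v_ : nat -> 'rV[R]_(n + 1),
      v_ @ \oo --> v & forall k, Omega (z k + t k *: v_ k)].

Definition polar_cone (R : realType) (N : nat) (T : set 'rV[R]_N) :
    set 'rV[R]_N :=
  [set xi | forall v, T v -> dot xi v <= 0].

Definition clarke_normal_cone_infty (R : realType) (n : nat)
    (Omega : set 'rV[R]_(n + 1)) : set 'rV[R]_(n + 1) :=
  polar_cone (clarke_tangent_cone_infty Omega).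

Definition clarke_subdiff_infty (R : realType) (n : nat) (f : 'rV[R]_n -> R) :
    set 'rV[R]_n :=
  [set u | clarke_normal_cone_infty (epi f) (row_mx u (-1)%:M)].

Definition convex_hull (R : realType) (n : nat) (A : set 'rV[R]_n) :
    set 'rV[R]_n :=
  smallest (@convex_set R 'rV[R]_n) A.

(* Main.v *)
(* The inclusion from left to right holds because the Clarke subdifferential is
   convex and, for a regular normal xi_k at z_k and a direction v of the Clarke
   tangent cone, steps t_k small enough (depending on z_k) turn
   <xi_k, t_k v_k> <= o(t_k |v_k|) into <xi, v> <= 0 in the limit.
   Conversely, let u be a Clarke subgradient at infinity. For every direction v
   and every c < <u, v>, the vector (v, c) is not tangent, so there are points x
   going to infinity and steps t going to 0 with f (x + t v) - f x > c t. A mean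
   value inequality gives near x a regular subgradient w with |w| <= 2 L and
   <w, v> >= c; a cluster point w of these lies in the limiting subdifferential
   at infinity and satisfies <w, v> >= <u, v>. Since the limiting subgradients
   of norm at most 2 L form a compact set, whose convex hull is closed by
   Caratheodory's theorem, u belongs to that hull. *)
Require Import Defs.
From HB Require Import structures.
From mathcomp Require Import all_boot all_order all_algebra.
From mathcomp Require Import all_classical all_reals all_analysis.
From mathcomp Require Import ring lra.
Import Order.TTheory GRing.Theory Num.Theory.
Import numFieldNormedType.Exports.
Local Open Scope classical_set_scope.
Local Open Scope ring_scope.

Set Implicit Arguments.
Unset Strict Implicit.
Unset Printing Implicit Defensive.

(** * Euclidean scalar product and norm, and their link with the library topology *)

Section Euclidean.
Variables (R : realType) (n : nat).
Implicit Types (u v w : 'rV[R]_n) (a : R).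

Lemma dotC u v : dot u v = dot v u.
Proof. by apply: eq_bigr => i _; rewrite mulrC. Qed.

Lemma dotDl u v w : dot (u + v) w = dot u w + dot v w.
Proof. by rewrite /dot -big_split; apply: eq_bigr => i _; rewrite mxE mulrDl. Qed.

Lemma dotZl a u v : dot (a *: u) v = a * dot u v.
Proof. by rewrite /dot mulr_sumr; apply: eq_bigr => i _; rewrite mxE mulrA. Qed.

Lemma dotDr u v w : dot u (v + w) = dot u v + dot u w.
Proof. by rewrite dotC dotDl !(dotC _ u). Qed.

Lemma dotZr a u v : dot u (a *: v) = a * dot u v.
Proof. by rewrite dotC dotZl dotC. Qed.

Lemma dotNl u v : dot (- u) v = - dot u v.
Proof. by rewrite -scaleN1r dotZl mulN1r. Qed.

Lemma dotNr u v : dot u (- v) = - dot u v.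
Proof. by rewrite dotC dotNl dotC. Qed.

Lemma dot0l v : dot 0 v = 0.
Proof. by rewrite -(scale0r 0) dotZl mul0r. Qed.

Lemma dot_subl u v w : dot (u - v) w = dot u w - dot v w.
Proof. by rewrite dotDl dotNl. Qed.

Lemma dot_sqrD u v : dot (u + v) (u + v) = dot u u + 2 * dot v u + dot v v.
Proof. by rewrite dotDl !dotDr (dotC u v); ring. Qed.

Lemma dot_ge0 u : 0 <= dot u u.
Proof. by apply: sumr_ge0 => i _; rewrite -expr2 sqr_ge0. Qed.

Lemma dot_eq0 u : dot u u = 0 -> u = 0.
Proof.
move=> /eqP; rewrite psumr_eq0; last by move=> i _; rewrite -expr2 sqr_ge0.
move=> /allP u0; apply/rowP => i; rewrite mxE.
by have := u0 i (mem_index_enum i); rewrite mulf_eq0 orbb => /eqP.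
Qed.

Lemma norm2_ge0 u : 0 <= norm2 u.
Proof. exact: sqrtr_ge0. Qed.

Lemma norm2_sqr u : norm2 u ^+ 2 = dot u u.
Proof. by rewrite sqr_sqrtr// dot_ge0. Qed.

Lemma norm2_le u a : 0 <= a -> (norm2 u <= a) = (dot u u <= a ^+ 2).
Proof. by move=> a0; rewrite -norm2_sqr ler_sqr// nnegrE norm2_ge0. Qed.

Lemma norm2N u : norm2 (- u) = norm2 u.
Proof. by rewrite /norm2 dotNl dotNr opprK. Qed.

Lemma norm2B u v : norm2 (u - v) = norm2 (v - u).
Proof. by rewrite -norm2N opprB. Qed.

Lemma norm2Z a u : norm2 (a *: u) = `|a| * norm2 u.
Proof. by rewrite /norm2 dotZl dotZr mulrA -expr2 sqrtrM ?sqr_ge0// sqrtr_sqr. Qed.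

(** For nonzero vectors, expand the square of [norm2 v *: u - norm2 u *: v] and divide by twice the
    product of the norms. *)
Lemma cauchy_schwarz u v : dot u v <= norm2 u * norm2 v.
Proof.
have [u0|u0] := eqVneq (norm2 u) 0.
  have -> : u = 0 by apply: dot_eq0; rewrite -norm2_sqr u0 expr0n.
  by rewrite dot0l mulr_ge0 ?norm2_ge0.
have [v0|v0] := eqVneq (norm2 v) 0.
  have -> : v = 0 by apply: dot_eq0; rewrite -norm2_sqr v0 expr0n.
  by rewrite dotC dot0l mulr_ge0 ?norm2_ge0.
have := dot_ge0 (norm2 v *: u - norm2 u *: v).
rewrite !(dotDl, dotDr, dotNl, dotNr, dotZl, dotZr) -!norm2_sqr (dotC v u).
have uv0 : 0 < norm2 u * norm2 v.
  by rewrite mulr_gt0// lt_def ?u0 ?v0 norm2_ge0.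
move=> H; have : 0 <= (norm2 u * norm2 v) * (norm2 u * norm2 v - dot u v) by lra.
by rewrite pmulr_rge0// subr_ge0.
Qed.

Lemma ler_norm2D u v : norm2 (u + v) <= norm2 u + norm2 v.
Proof.
rewrite norm2_le ?addr_ge0 ?norm2_ge0// dotDl !dotDr (dotC v u) -!norm2_sqr.
by have := cauchy_schwarz u v; lra.
Qed.

Lemma ler_norm2B u v : norm2 u - norm2 v <= norm2 (u + v).
Proof. by have := ler_norm2D (u + v) (- v); rewrite addrK norm2N; lra. Qed.

Lemma ler_coord_norm2 u i : `|u 0 i| <= norm2 u.
Proof.
rewrite -(@ler_sqr _ `|_| (norm2 u)) ?nnegrE ?norm2_ge0// norm2_sqr real_normK ?num_real//.
rewrite /dot (bigD1 i)//= -expr2 lerDl sumr_ge0// => j _.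
by rewrite -expr2 sqr_ge0.
Qed.

Lemma ler_mx_norm_norm2 u : `|u| <= norm2 u.
Proof.
rewrite [`|u|]mx_normrE; apply: bigmax_le => [|[i j] _] /=; first exact: norm2_ge0.
by rewrite ord1; exact: ler_coord_norm2.
Qed.

Lemma cvg_dot (T : Type) (F : set_system T) {FF : Filter F}
    (g h : T -> 'rV[R]_n) u v :
  g @ F --> u -> h @ F --> v -> (fun x => dot (g x) (h x)) @ F --> dot u v.
Proof.
move=> gu hv; apply: cvg_big => [|i _]; first exact: add_continuous.
apply: cvgM.
  exact: (cvg_comp g (fun w => w 0 i) gu (@coord_continuous _ _ _ 0 i u)).
exact: (cvg_comp h (fun w => w 0 i) hv (@coord_continuous _ _ _ 0 i v)).
Qed.

Lemma cvg_norm2 (T : Type) (F : set_system T) {FF : Filter F}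
    (g : T -> 'rV[R]_n) u :
  g @ F --> u -> (fun x => norm2 (g x)) @ F --> norm2 u.
Proof.
move=> gu; rewrite /norm2.
exact: (cvg_comp (fun x => dot (g x) (g x)) Num.sqrt (cvg_dot gu gu)
  (@sqrt_continuous R (dot u u))).
Qed.

Lemma norm2_continuous : continuous (@norm2 R n).
Proof. by move=> u; exact: (cvg_norm2 (@cvg_id _ (nbhs u))). Qed.

Lemma near_norm2 u e : 0 < e -> \forall v \near u, norm2 (v - u) < e.
Proof.
move=> e0; have : norm2 (v - u) @[v --> u] --> norm2 (u - u).
  exact: (cvg_norm2 (cvgB (@cvg_id _ (nbhs u)) (cvg_cst u))).
rewrite subrr {2}/norm2 dot0l sqrtr0 => /cvgrPdist_lt /(_ _ e0).
by apply: filterS => v; rewrite sub0r normrN ger0_norm ?norm2_ge0.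
Qed.

Lemma closed_cball2 r : closed (@cball2 R n r).
Proof.
apply: (@preimage_closed _ _ (@norm2 R n) [set x | x <= r]).
  by move=> x _; exact: norm2_continuous.
exact: closed_le.
Qed.

Lemma compact_cball2 r : compact (@cball2 R n r).
Proof.
have cK := @rV_compact R n (fun=> `[- r, r]%classic) (fun=> @segment_compact R (- r) r).
apply: subclosed_compact cK _; first exact: closed_cball2.
move=> u /= ur i; rewrite in_itv/= -ler_norml.
exact: le_trans (ler_coord_norm2 u i) ur.
Qed.

End Euclidean.

(** Meant for rows whose entries are themselves vectors, that is, tuples of points. *)
Lemma mx_entry_continuous (T : topologicalType) m n (i : 'I_m) (j : 'I_n) :
  continuous (fun M : 'M[T]_(m, n) => M i j).
Proof.
move=> M V /= MV.
exists (fun i' j' => [set y | i' = i -> j' = j -> V y]) => [i' j'|N /(_ i j)] /=.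
  have [->|i'i] := eqVneq i' i; last first.
    by apply: nearW => y /= eqi; rewrite eqi eqxx in i'i.
  have [->|j'j] := eqVneq j' j; last first.
    by apply: nearW => y /= _ eqj; rewrite eqj eqxx in j'j.
  by apply: filterS MV => y Vy.
exact.
Qed.

(** * Convex combinations, Caratheodory reduction and hulls of compact sets *)

Section ConvexHull.
Variables (R : realType) (n : nat).
Implicit Types (A C : set 'rV[R]_n) (u v w : 'rV[R]_n).

Lemma convex_setP C : convex_set C <->
  forall x y (t : R), C x -> C y -> 0 <= t -> t <= 1 ->
    C (t *: x + (1 - t) *: y).
Proof.
split=> [cC x y t Cx Cy t0 t1|cC x y l].
  have := cC x y (Itv01 t0 t1); rewrite !in_setE; exact.
rewrite !in_setE => Cx Cy; exact: cC.
Qed.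

Lemma convex_set_sum C m (l : 'I_m -> R) (a : 'I_m -> 'rV[R]_n) :
  convex_set C -> (forall i, 0 <= l i) -> \sum_i l i = 1 ->
  (forall i, C (a i)) -> C (\sum_i l i *: a i).
Proof.
move=> /convex_setP cC; elim: m l a => [|m IH] l a l0 l1 Ca.
  by move: l1; rewrite big_ord0 => /eqP; rewrite eq_sym oner_eq0.
rewrite big_ord_recl; move: l1; rewrite big_ord_recl.
set s := \sum_(i < m) l (lift ord0 i) => l1.
have s0 : 0 <= s by apply: sumr_ge0.
have [s_eq0|sN0] := eqVneq s 0.
  rewrite big1 ?addr0 => [|i _].
    by move: l1; rewrite s_eq0 addr0 => ->; rewrite scale1r.
  have /allP/(_ i (mem_index_enum i)) : all (fun i => true ==> (l (lift ord0 i) == 0))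
      (index_enum 'I_m).
    by rewrite -psumr_eq0// -/s s_eq0.
  by move=> /eqP ->; rewrite scale0r.
(* The tail is divided by its total weight [s = 1 - l ord0], so that the induction hypothesis
   applies to it. *)
have -> : \sum_(i < m) l (lift ord0 i) *: a (lift ord0 i) =
    (1 - l ord0) *: \sum_(i < m) (l (lift ord0 i) / s) *: a (lift ord0 i).
  have -> : 1 - l ord0 = s by rewrite -l1 addrC addKr.
  rewrite scaler_sumr; apply: eq_bigr => i _.
  by rewrite scalerA mulrCA divff// mulr1.
apply: cC => //; last by rewrite -l1 lerDl.
apply: IH => [i||i]; [by rewrite divr_ge0| |exact: Ca].
by rewrite -mulr_suml divff.
Qed.

(** The matrix with rows [(a i, 1)] has more rows than columns, hence a nonzero left kernel vector;
    the column of ones makes its entries sum to zero, so they cannot all be nonpositive. *)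
Lemma affine_dependence (a : 'I_n.+2 -> 'rV[R]_n) :
  exists mu : 'I_n.+2 -> R,
    [/\ exists i, 0 < mu i, \sum_i mu i = 0 & \sum_i mu i *: a i = 0].
Proof.
pose M : 'M[R]_(n.+2, n + 1) := row_mx (\matrix_i a i) (const_mx 1).
have : kermx M != 0.
  rewrite kermx_eq0 /row_free; apply/negP => /eqP rM.
  by have := rank_leq_col M; rewrite rM addn1 ltnn.
move=> /rowV0Pn[v /sub_kermxP]; rewrite mul_mx_row -row_mx0.
move=> /eq_row_mx[va v1] v0.
have sv : \sum_i v 0 i = 0.
  have /rowP/(_ 0) := v1; rewrite !mxE => v1_0.
  rewrite -[RHS]v1_0; apply: eq_bigr => i _; by rewrite mxE mulr1.
exists (v 0); split=> //; last first.
  by rewrite -[RHS]va mulmx_sum_row; apply: eq_bigr => i _; rewrite rowK.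
apply/existsP; apply: contraNT v0; rewrite negb_exists => /forallP v_le0.
apply/eqP/rowP => i; rewrite mxE; apply/eqP.
have /allP/(_ i (mem_index_enum i)) : all (fun i => true ==> (- v 0 i == 0))
    (index_enum 'I_n.+2).
  rewrite -psumr_eq0 ?sumrN ?sv ?oppr0// => j _.
  by rewrite oppr_ge0 leNgt.
by rewrite oppr_eq0.
Qed.

(** Subtracting a multiple of an affine dependence [mu] changes neither the total weight nor the
    combination. The smallest ratio [l i / mu i] with [mu i > 0] is the largest multiple that keeps
    the weights nonnegative, and it cancels one of them. *)
Lemma caratheodory_step (l : 'I_n.+2 -> R) (a : 'I_n.+2 -> 'rV[R]_n) :
  (forall i, 0 <= l i) -> \sum_i l i = 1 ->
  exists l' : 'I_n.+2 -> R, [/\ forall i, 0 <= l' i, \sum_i l' i = 1,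
    \sum_i l' i *: a i = \sum_i l i *: a i & exists i, l' i = 0].
Proof.
move=> l0 l1; have [mu [[i0 mu0] mus mua]] := affine_dependence a.
have [i mui Hi] := @arg_minP _ R _ i0 (fun i => 0 < mu i) (fun i => l i / mu i) mu0.
pose t := l i / mu i.
have t0 : 0 <= t by rewrite divr_ge0// ltW.
exists (fun j => l j - t * mu j); split=> [j|||].
- have [muj|muj] := ltP 0 (mu j).
    by rewrite subr_ge0 -ler_pdivlMr//; exact: Hi.
  by rewrite subr_ge0 (le_trans _ (l0 j))// mulr_ge0_le0.
- by rewrite sumrB -mulr_sumr mus mulr0 subr0.
- under eq_bigr do rewrite scalerBl -scalerA.
  by rewrite sumrB -scaler_sumr mua scaler0 subr0.
- by exists i; rewrite /t divfK ?subrr// gt_eqF.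
Qed.

Lemma compact_simplex m :
  compact [set l : 'rV[R]_m | (forall i, 0 <= l 0 i) /\ \sum_i l 0 i = 1].
Proof.
have cK := @rV_compact R m (fun=> `[0, 1]%classic) (fun=> @segment_compact R 0 1).
have -> : [set l : 'rV[R]_m | (forall i, 0 <= l 0 i) /\ \sum_i l 0 i = 1] =
    [set l : 'rV[R]_m | forall i, `[0, 1]%classic (l ord0 i)] `&`
    [set l : 'rV[R]_m | \sum_i l 0 i = 1].
  apply/seteqP; split=> l /= [l0 l1]; split=> // i; last first.
    by have /andP[] := l0 i.
  rewrite /= in_itv/= l0/= -l1 (bigD1 i)//= lerDl.
  by apply: sumr_ge0.
apply: compact_closedI => //.
apply: (@preimage_closed _ _ (fun l : 'rV[R]_m => \sum_i l 0 i) [set x | x = 1]).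
  move=> l _; apply: continuous_big => [|i _]; first exact: add_continuous.
  exact: coord_continuous.
exact: closed_eq.
Qed.

(* Let p be the point nearest to u among the combinations of n+2 points of A.
   If p <> u, some w in A lies strictly on the side of u of the hyperplane
   through p orthogonal to u - p; as p only uses n+1 points, w can be mixed in,
   giving a nearer point. *)
Lemma support_convex_hull A u : compact A ->
  (forall v, exists2 w, A w & dot u v <= dot w v) -> convex_hull A u.
Proof.
move=> cA supA.
have [w0 Aw0 _] := supA 0.
pose S := [set l : 'rV[R]_n.+2 | (forall i, 0 <= l 0 i) /\ \sum_i l 0 i = 1].
pose V := [set a : 'rV['rV[R]_n]_n.+2 | forall i, A (a ord0 i)].
pose comb (p : 'rV[R]_n.+2 * 'rV['rV[R]_n]_n.+2) := \sum_i p.1 0 i *: p.2 0 i.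
have cSV : compact (S `*` V).
  apply: compact_setX; first exact: compact_simplex.
  exact: (@rV_compact _ n.+2 (fun=> A) (fun=> cA)).
have SV0 : S `*` V !=set0.
  exists (delta_mx 0 0, const_mx w0); split; last by move=> i; rewrite mxE.
  split=> [i|]; first by rewrite mxE.
  rewrite (bigD1 ord0)//= big1 => [|i i0]; rewrite mxE ?eqxx ?addr0//.
  by rewrite (negbTE i0).
have comb_cont : continuous comb.
  apply: continuous_big => [|i _ p]; first exact: add_continuous.
  apply: cvgZ.
    exact: (cvg_comp fst (fun l : 'rV[R]_n.+2 => l 0 i) cvg_fst
      (@coord_continuous _ _ _ 0 i p.1)).
  exact: (cvg_comp snd (fun a : 'rV['rV[R]_n]_n.+2 => a 0 i) cvg_snd
    (@mx_entry_continuous _ _ _ 0 i p.2)).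
have dist_cont : continuous (fun p => norm2 (u - comb p)).
  move=> p.
  exact: (cvg_norm2 (cvgB (cvg_cst u) (comb_cont p))).
have [[l a]] := compact_EVT_min SV0 cSV (continuous_subspaceT dist_cont).
rewrite in_setE => -[/= [l0 l1] Va] pmin.
have hull_comb : convex_hull A (comb (l, a)).
  by move=> C [cC sAC]; apply: convex_set_sum => // i; apply: sAC; exact: Va.
have [<-//|pu] := eqVneq (comb (l, a)) u.
have [l' [l'0 l'1 l'a [k l'k]]] := caratheodory_step (a 0) l0 l1.
set p := comb (l, a) in pmin pu; pose d := u - p.
have [w Aw uw] := supA d.
have l'p : \sum_i l' i *: a 0 i = p by [].
have dd : 0 < dot d d.
  rewrite lt_def dot_ge0 andbT; apply: contra_neq pu => /dot_eq0 /eqP.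
  by rewrite subr_eq0 => /eqP ->.
(* The slot [k] of zero weight receives [w] with weight [s], the other weights being scaled by
   [1 - s]; hence [p + s *: (w - p)] is again a competitor. *)
have near_le s : 0 <= s -> s <= 1 -> dot d d <= dot (d - s *: (w - p)) (d - s *: (w - p)).
  move=> s0 s1.
  pose l2 := \row_i ((1 - s) * l' i + (if i == k then s else 0)).
  pose a2 := \row_i (if i == k then w else a 0 i).
  have := pmin (l2, a2); rewrite in_setE.
  have -> : comb (l2, a2) = p + s *: (w - p).
    rewrite /comb /= (bigD1 k)//= !mxE eqxx l'k mulr0 add0r.
    under eq_bigr => i ik do rewrite !mxE (negbTE ik) addr0 -scalerA.
    rewrite -scaler_sumr.
    have -> : \sum_(i < n.+2 | i != k) l' i *: a 0 i = p.
      by rewrite -l'p [RHS](bigD1 k)//= l'k scale0r add0r.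
    by rewrite scalerBl scale1r scalerBr addrC -addrA [- _ + _]addrC.
  rewrite opprD addrA -/d norm2_le ?norm2_ge0// norm2_sqr; apply; split.
    split=> [i|]; first by rewrite mxE addr_ge0 ?mulr_ge0 ?subr_ge0//; case: ifP.
    under eq_bigr do rewrite mxE.
    rewrite big_split/= -mulr_sumr l'1 mulr1 -big_mkcond big_pred1_eq.
    by rewrite subrK.
  by move=> i; rewrite mxE; case: ifP => // _; exact: Va.
have dw : dot d d <= dot (w - p) d.
  by rewrite {1}/d !dot_subl lerD2r.
set e := w - p in dw near_le.
pose q := dot e e.
have q0 : 0 <= q := dot_ge0 _.
have Dq : 0 < dot d d + q by rewrite ltr_wpDr.
(* With this [s], [s * q <= dot d d], whereas minimality forces
   [s * q >= 2 * dot e d >= 2 * dot d d]. *)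
pose s := dot d d / (dot d d + q).
have s_gt0 : 0 < s by rewrite divr_gt0.
have s1 : s <= 1 by rewrite ler_pdivrMr// mul1r lerDl.
have := near_le s (ltW s_gt0) s1.
rewrite dot_sqrD -scaleNr !dotZl dotZr -/q => near_s.
have : 0 <= s * (s * q - 2 * dot e d) by lra.
rewrite pmulr_rge0// => sq.
have : s * q <= dot d d.
  by rewrite mulrAC ler_pdivrMr// ler_pM2l// lerDr ltW.
by lra.
Qed.

End ConvexHull.

(** * Normal and tangent cones of an epigraph at infinity *)

Section Infinity.
Variables (R : realType) (n : nat).
Implicit Types (f : 'rV[R]_n -> R) (u x y : 'rV[R]_n).
Implicit Types (z zeta xi : 'rV[R]_(n + 1)) (Omega : set 'rV[R]_(n + 1)).

Lemma dot_split z zeta : dot z zeta =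
  dot (lsubmx z) (lsubmx zeta) + rsubmx z 0 0 * rsubmx zeta 0 0.
Proof.
rewrite /dot big_split_ord big_ord1; congr (_ + _); last by rewrite !mxE.
by apply: eq_bigr => i _; rewrite !mxE.
Qed.

Lemma dot_row_mx u (s : R) z :
  dot (row_mx u s%:M) z = dot u (lsubmx z) + s * rsubmx z 0 0.
Proof. by rewrite dot_split row_mxKl row_mxKr mxE eqxx. Qed.

Lemma norm2_row_mx u : norm2 (row_mx u 0 : 'rV_(n + 1)) = norm2 u.
Proof. by rewrite /norm2 dot_split row_mxKl row_mxKr mxE mulr0 addr0. Qed.

Lemma norm2_lsubmx z : norm2 (lsubmx z) <= norm2 z.
Proof.
by rewrite norm2_le ?norm2_ge0// norm2_sqr dot_split lerDl -expr2 sqr_ge0.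
Qed.

(** A form without sequences, which spares diagonal arguments and extraction of subsequences. *)
Lemma normal_cone_inftyP Omega zeta : normal_cone_infty Omega zeta <->
  forall e, 0 < e -> exists z xi, [/\ Omega z, e^-1 < norm2 (lsubmx z),
    regular_normal_cone Omega z xi & norm2 (zeta - xi) < e].
Proof.
split=> [[z [xi [Oz zinf nxi xizeta]]] e e0|H].
  have /cvgryPgt/(_ e^-1) zfar := zinf.
  have xinear := xizeta _ (near_norm2 zeta e0).
  have [k _ Hk] := filterI zfar xinear.
  have [kfar knear] := Hk k (leqnn k).
  by exists (z k), (xi k); split=> //; rewrite norm2B.
have {}H k := H k.+1%:R^-1 (ltac:(by rewrite invr_gt0)).
have [z /choice[xi Hzxi]] := choice H.
exists z, xi; split=> [k||k|]; try by have [] := Hzxi k.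
  apply/cvgryPgt => M; exists (Num.truncn `|M|).+1 => // k /= Mk.
  have [_ + _ _] := Hzxi k; rewrite invrK; apply: lt_trans.
  rewrite (le_lt_trans (ler_norm M))// (lt_le_trans (truncnS_gt _))// ler_nat.
  exact: leq_trans Mk _.
apply/cvgrPdist_lt => e e0; near=> k.
rewrite (le_lt_trans (ler_mx_norm_norm2 _))//.
have [_ _ _ /lt_trans] := Hzxi k; apply.
by near: k; exact: (near_infty_natSinv_lt (PosNum e0)).
Unshelve. all: end_near. Qed.

Lemma normal_cone_sub_clarke Omega :
  normal_cone_infty Omega `<=` clarke_normal_cone_infty Omega.
Proof.
move=> zeta [z [xi [Oz zinf nxi xizeta]]] v Tv.
suff H e : 0 < e -> dot zeta v <= e * norm2 v.
  rewrite leNgt; apply/negP => p0.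
  have v1 : 0 < norm2 v + 1 by rewrite ltr_wpDl ?norm2_ge0.
  have := H (dot zeta v / (norm2 v + 1)) (divr_gt0 p0 v1).
  rewrite mulrAC ler_pdivlMr// ler_pM2l//; lra.
move=> e0.
have v1 : 0 < `|v| + 1 by rewrite ltr_wpDl.
(* The step [t k] has to be fixed before tangency supplies [v_ k], so the estimate is required for
   every [w] in a ball that contains [v_ k] for large [k]. *)
have /choice[t Ht] : forall k, exists t : R, [/\ 0 < t, t <= k.+1%:R^-1 &
    forall w, `|w| < `|v| + 1 -> Omega (z k + t *: w) ->
      dot (xi k) w <= e * norm2 w].
  move=> k; have /nbhs_ballP[d /= d0 Hd] := nxi k e e0.
  pose t := Num.min (d / (`|v| + 1)) k.+1%:R^-1.
  have t0 : 0 < t by rewrite lt_min divr_gt0//= invr_gt0.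
  exists t; split=> // [|w wv Ow]; first by rewrite ge_min lexx orbT.
  have := Hd (z k + t *: w); rewrite -ball_normE /= opprD addNKr.
  rewrite normrN normrZ gtr0_norm// => /(_ _ Ow).
  rewrite addrC addKr dotZr norm2Z gtr0_norm// mulrCA ler_pM2l//; apply.
  have : t * `|w| < t * (`|v| + 1) by rewrite ltr_pM2l.
  move=> /lt_le_trans; apply; rewrite -ler_pdivlMr//.
  by rewrite /t ge_min lexx.
have t_cvg : t @ \oo --> (0 : R).
  apply/cvgrPdist_lt => d d0; near=> k.
  have [tk0 tk _] := Ht k; rewrite sub0r normrN gtr0_norm// (le_lt_trans tk)//.
  by near: k; exact: (near_infty_natSinv_lt (PosNum d0)).
have [v_ v_v Ov] := Tv z t Oz zinf (fun k => ltac:(by have [] := Ht k)) t_cvg.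
apply: (ler_cvg_to (cvg_dot xizeta v_v) (cvgM (cvg_cst e) (cvg_norm2 v_v))).
near=> k; have [_ _] := Ht k; apply; last exact: Ov.
near: k; apply: (cvgr_lt `|v|); last by rewrite ltrDl.
exact: cvg_norm.
Unshelve. all: end_near. Qed.

Lemma convex_clarke_subdiff f : convex_set (clarke_subdiff_infty f).
Proof.
apply/convex_setP => u w t uC wC t0 t1 v Tv.
have := uC v Tv; have := wC v Tv; rewrite !dot_row_mx dotDl !dotZl.
move=> Hw Hu.
have H1 : t * (dot u (lsubmx v) + -1 * rsubmx v 0 0) <= 0 by rewrite mulr_ge0_le0.
have H2 : (1 - t) * (dot w (lsubmx v) + -1 * rsubmx v 0 0) <= 0.
  by rewrite mulr_ge0_le0// subr_ge0.
by lra.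
Qed.

(** Otherwise the difference quotients along [v] would be at most [c] far out and for small steps,
    so [(v, c)] would be tangent and [dot u v <= c]. *)
Lemma clarke_difference_quotient f u v (c M : R) :
  clarke_subdiff_infty f u -> c < dot u v -> 0 < M ->
  exists x t, [/\ M < norm2 x, 0 < t, t < M^-1 & c * t < f (x + t *: v) - f x].
Proof.
move=> uC cuv M0; apply: contrapT => H.
suff /uC : clarke_tangent_cone_infty (epi f) (row_mx v c%:M).
  by rewrite dot_row_mx row_mxKl row_mxKr mxE eqxx /=; lra.
move=> z t Oz zinf t0 t_cvg.
pose x k := lsubmx (z k).
pose good k := (M < norm2 (x k)) && (t k < M^-1).
(* Membership is required at every [k]. While [k] is not good, the exact difference quotient serves
   as last coordinate; all large [k] are good, so the sequence is eventually constant. *)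
exists (fun k => row_mx v (if good k then c
    else (f (x k + t k *: v) - f (x k)) / t k)%:M).
  apply: cvg_near_cst; near=> k.
  suff -> : good k by [].
  apply/andP; split; near: k.
    by have /cvgryPgt := zinf; exact.
  by apply: (cvgr_lt 0 t_cvg); rewrite invr_gt0.
move=> k; rewrite /epi /= linearD linearZ /= row_mxKl.
rewrite [rsubmx _]linearD linearZ /= row_mxKr !mxE eqxx mulr1n -/(x k).
have := Oz k; rewrite /epi /= -/(x k) !mxE => fz.
case: ifPn => [/andP[xk tk]|_]; last first.
  by rewrite mulrC divfK ?gt_eqF//; lra.
suff : f (x k + t k *: v) - f (x k) <= c * t k by lra.
by rewrite leNgt; apply/negP => ?; apply: H; exists (x k), (t k).
Unshelve. all: end_near. Qed.

Lemma closed_subdiff_infty f : closed (subdiff_infty f).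
Proof.
move=> u clu; apply/normal_cone_inftyP => e e0.
have e2 : 0 < e / 2 by rewrite divr_gt0.
have [w [/normal_cone_inftyP/(_ _ e2)[z [xi [Oz zfar nxi wxi]]] /= uw]] :=
  clu _ (near_norm2 u e2).
exists z, xi; split=> //.
  by apply: lt_trans zfar; rewrite ltf_pV2 ?posrE//; lra.
have -> : row_mx u (-1)%:M - xi = row_mx (u - w) 0 + (row_mx w (-1)%:M - xi).
  by rewrite addrA add_row_mx subrK add0r.
rewrite (le_lt_trans (ler_norm2D _ _))// norm2_row_mx (norm2B u); lra.
Qed.

End Infinity.

(** * Regular and limiting subgradients of a function Lipschitz at infinity *)

Section LipschitzAtInfinity.
Variables (R : realType) (n : nat) (f : 'rV[R]_n -> R) (L r : R).
Hypotheses (L0 : 0 < L) (r0 : 0 < r).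
Hypothesis f_lip : forall x x' : 'rV[R]_n, (~` cball2 r) x ->
  (~` cball2 r) x' -> `|f x - f x'| <= L * norm2 (x - x').
Implicit Types (u v w x y h : 'rV[R]_n).

Lemma lipschitz_far x y : r < norm2 x -> r < norm2 y ->
  `|f x - f y| <= L * norm2 (x - y).
Proof. by move=> xr yr; apply: f_lip; rewrite /cball2 /= leNgt => /negP; exact. Qed.

Lemma continuous_far x : r < norm2 x -> {for x, continuous f}.
Proof.
move=> xr; apply/(@cvgrPdist_lt _ _ _ (nbhs x)) => e e0.
have near_r : \forall y \near x, r < norm2 y.
  by have /cvgr_gt := @norm2_continuous R n x; exact.
apply: filterS2 near_r (near_norm2 x (divr_gt0 e0 L0)) => y yr yx.
rewrite (le_lt_trans (lipschitz_far xr yr))// mulrC -ltr_pdivlMr// norm2B.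
exact: yx.
Qed.

(* Penalization: minimize f y - c s + N |y - x - s v|^2 over s in [0, t] and
   y = x + s v + h with |h| <= 1. For N large the minimum has s < t and
   |h| < 1, so w = - 2 N h is a regular subgradient of f at y, and the one-sided
   optimality in s gives c <= <w, v>. *)
Lemma mean_value_subgradient x v (t c : R) :
  0 < t -> r + 1 + t * norm2 v < norm2 x -> c * t < f (x + t *: v) - f x ->
  exists y w, [/\ norm2 x - t * norm2 v - 1 <= norm2 y, norm2 w <= 2 * L,
    c <= dot w v &
    regular_normal_cone (epi f) (row_mx y (f y)%:M) (row_mx w (-1)%:M)].
Proof.
move=> t0 xfar; rewrite -subr_gt0; set g := _ - _ => g0.
(* [N > L] will give [norm2 h < 1], and [N * g > L ^+ 2] will exclude [s = t]. *)
pose N := L + L ^+ 2 / g.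
have LN : L < N by rewrite ltrDl divr_gt0// exprn_gt0.
have N0 : 0 < N := lt_trans L0 LN.
have NL : L ^+ 2 < N * g.
  by rewrite mulrDl divfK ?gt_eqF// ltrDr mulr_gt0.
have far s h : 0 <= s -> s <= t -> norm2 h <= 1 ->
    norm2 x - t * norm2 v - 1 <= norm2 (x + s *: v + h).
  move=> s0 st h1; rewrite -(addrA x).
  have := ler_norm2B x (s *: v + h); have := ler_norm2D (s *: v) h.
  rewrite norm2Z ger0_norm//.
  have := ler_wpM2r (norm2_ge0 v) st.
  by lra.
have farr s h : 0 <= s -> s <= t -> norm2 h <= 1 -> r < norm2 (x + s *: v + h).
  by move=> s0 st h1; apply: lt_le_trans (far s h s0 st h1); lra.
pose F (p : R * 'rV[R]_n) := f (x + p.1 *: v + p.2) - c * p.1 + N * dot p.2 p.2.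
pose K := `[0, t]%classic `*` @cball2 R n 1.
have cK : compact K.
  by apply: compact_setX; [exact: segment_compact|exact: compact_cball2].
have norm20 : norm2 (0 : 'rV[R]_n) = 0 by rewrite /norm2 dot0l sqrtr0.
have K0 : K !=set0.
  by exists (0, 0); split; rewrite /= ?in_itv/= ?lexx ?(ltW t0)// /cball2/= norm20.
have cF : {within K, continuous F}.
  apply: continuous_in_subspaceT => -[s h]; rewrite in_setE => -[/= + h1].
  rewrite in_itv/= => /andP[s0 st].
  have arg_cvg : x + p.1 *: v + p.2 @[p --> (s, h)] --> x + s *: v + h.
    apply: cvgD; last exact: cvg_snd.
    apply: cvgD; first exact: cvg_cst.
    by apply: cvgZr_tmp; exact: cvg_fst.
  apply: cvgD.
    apply: cvgB; last by apply: cvgM; [exact: cvg_cst|exact: cvg_fst].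
    exact: (cvg_comp _ f arg_cvg (continuous_far (farr s h s0 st h1))).
  apply: cvgM; first exact: cvg_cst.
  by apply: cvg_dot; exact: cvg_snd.
have [[s h]] := compact_EVT_min K0 cK cF.
rewrite in_setE => -[/= + h1]; rewrite in_itv/= /cball2/= in h1 * => /andP[s0 st] minF.
pose d := norm2 h; pose y := x + s *: v + h.
have {}minF s' h' : 0 <= s' -> s' <= t -> norm2 h' <= 1 ->
    f y - c * s + N * d ^+ 2 <=
    f (x + s' *: v + h') - c * s' + N * norm2 h' ^+ 2.
  move=> s'0 s't h'1; rewrite !norm2_sqr; apply: (minF (s', h')).
  by rewrite in_setE; split=> //=; rewrite in_itv/= s'0.
have d0 : 0 <= d := norm2_ge0 h.
have lip_y s' : 0 <= s' -> s' <= t -> s' = s ->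
    f (x + s' *: v) - f y <= L * d.
  move=> s'0 s't ->; have -> : d = norm2 (x + s *: v + 0 - y).
    by rewrite addr0 opprD addNKr norm2N.
  rewrite -[in leLHS](addr0 (x + s *: v)) (le_trans (ler_norm _))//.
  by apply: lipschitz_far; apply: farr; rewrite ?norm20.
(* Comparison of the minimum with [(s, 0)] gives [N * d ^+ 2 <= L * d]. *)
have Nd : N * d <= L.
  have := minF s 0 s0 st; rewrite norm20 => /(_ ler01); rewrite addr0.
  have := lip_y s s0 st erefl.
  have [->|dN0] := eqVneq d 0; first by move=> _ _; rewrite mulr0 ltW.
  have dgt0 : 0 < d by rewrite lt_def dN0.
  move=> H1 H2; rewrite -(ler_pM2r dgt0); lra.
have d_lt1 : d < 1 by rewrite -(ltr_pM2l N0) mulr1 (le_lt_trans Nd).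
(* If [s = t], comparison with [(0, 0)] gives [g + N * d ^+ 2 <= L * d]; multiplied by [N], with
   [N * d <= L], this contradicts [NL]. *)
have s_lt_t : s < t.
  rewrite lt_neqAle st andbT; apply/eqP => s_eq.
  have := minF 0 0 (lexx _) (ltW t0); rewrite norm20 => /(_ ler01).
  rewrite scale0r !addr0 => H1.
  have := lip_y t (ltW t0) (lexx _) (esym s_eq) => H2.
  have : g + N * d ^+ 2 <= L * d by rewrite /g; rewrite s_eq in H1; lra.
  rewrite -(ler_pM2l N0).
  have : N * (L * d) <= L * L by rewrite mulrCA ler_pM2l.
  have : 0 <= (N * d) ^+ 2 by exact: sqr_ge0.
  lra.
exists y, ((- 2 * N) *: h); split.
- exact: far.
- rewrite norm2Z mulNr normrN gtr0_norm ?mulr_gt0// -/d; lra.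
- rewrite leNgt; apply/negP => cw; rewrite dotZl in cw.
  pose e := c - - 2 * N * dot h v.
  have e0 : 0 < e by rewrite subr_gt0.
  have v0 : 0 <= norm2 v := norm2_ge0 v.
  have v1 : 0 < norm2 v + 1 by lra.
  have Nv1 : 0 < N * norm2 v ^+ 2 + 1 by rewrite ltr_wpDl// mulr_ge0 ?sqr_ge0 ?ltW.
  (* The competitor [(s + q, h - q *: v)] leaves [y] unchanged, so [f] cancels and only
     [q * e <= N * q ^+ 2 * norm2 v ^+ 2] remains. The three bounds on [q] keep the competitor
     admissible and contradict this inequality. *)
  pose q := Num.min (t - s) (Num.min ((1 - d) / (norm2 v + 1))
    (e / (N * norm2 v ^+ 2 + 1))).
  have q0 : 0 < q by rewrite !lt_min subr_gt0 s_lt_t !divr_gt0// subr_gt0.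
  have qt : q <= t - s by rewrite /q ge_min lexx.
  have qd : q * (norm2 v + 1) <= 1 - d.
    by rewrite -ler_pdivlMr// /q !ge_min lexx !orbT.
  have qe : q * (N * norm2 v ^+ 2 + 1) <= e.
    by rewrite -ler_pdivlMr// /q !ge_min lexx !orbT.
  have := minF (s + q) (h - q *: v); have := ler_norm2D h (- (q *: v)).
  rewrite norm2N norm2Z gtr0_norm// -/d => hv.
  have -> : x + (s + q) *: v + (h - q *: v) = y.
    by rewrite /y scalerDl -!addrA; congr (_ + (_ + _)); rewrite addrCA subrr addr0.
  rewrite norm2_sqr dot_sqrD -!norm2_sqr norm2N norm2Z gtr0_norm// -/d.
  rewrite dotNl dotZl (dotC v h) => /(_ ltac:(lra) ltac:(lra)).
  have -> : norm2 (h - q *: v) <= 1 by lra.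
  move=> /(_ isT) H.
  have : 0 <= q * (q * (N * norm2 v ^+ 2) - e) by rewrite /e; lra.
  by rewrite pmulr_rge0//; lra.
- move=> e e0.
  (* Moving [y] by [k] amounts to the competitor [(s, h + k)], admissible when [norm2 k < 1 - d].
     Minimality leaves the quadratic error [N * norm2 k ^+ 2], which is at most [e * b] once
     [b < e / N]. *)
  have m0 : 0 < Num.min (e / N) (1 - d) by rewrite lt_min divr_gt0//= subr_gt0.
  have := near_norm2 (row_mx y (f y)%:M) m0; apply: filterS => z.
  set b := norm2 (z - _); rewrite lt_min => /andP[be bd].
  rewrite /epi/= => Oz.
  pose k := lsubmx z - y.
  have lk : lsubmx (z - row_mx y (f y)%:M) = k by rewrite linearB/= row_mxKl.
  have kb : norm2 k <= b by rewrite -lk norm2_lsubmx.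
  have rk : rsubmx (z - row_mx y (f y)%:M) 0 0 = rsubmx z 0 0 - f y.
    by rewrite linearB/= row_mxKr !mxE eqxx mulr1n.
  rewrite dot_row_mx lk rk.
  have := minF s (h + k) s0 st; have := ler_norm2D h k; rewrite -/d => hk.
  have -> : x + s *: v + (h + k) = lsubmx z by rewrite addrA -/y addrC subrK.
  rewrite norm2_sqr dot_sqrD -!norm2_sqr -/d (dotC k h) dotZl.
  have -> : norm2 (h + k) <= 1 by lra.
  move=> /(_ isT) H.
  have Hk : norm2 k ^+ 2 <= b ^+ 2 by rewrite ler_sqr// nnegrE norm2_ge0.
  have : N * b ^+ 2 <= e * b.
    rewrite expr2 mulrA ler_wpM2r ?norm2_ge0// mulrC -ler_pdivlMr//.
    exact: ltW.
  have := ler_wpM2l (ltW N0) Hk.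
  by lra.
Qed.

Lemma subdiff_infty_directional u v : clarke_subdiff_infty f u ->
  exists w, [/\ subdiff_infty f w, norm2 w <= 2 * L & dot u v <= dot w v].
Proof.
move=> uC.
(* Since [M k > 1], the step is less than 1 and moves points by at most [norm2 v]; the other terms
   then place [x] beyond the radius demanded by the mean value inequality and [y] beyond [k.+1]. *)
pose M k := k.+1%:R + r + 1 + norm2 v.
have v0 := norm2_ge0 v.
have k1 k : 1 <= k.+1%:R :> R by rewrite ler1n.
have M1 k : 1 < M k by rewrite /M; move: (k1 k) v0 r0; lra.
have /choice[w Hw] : forall k, exists w, exists2 y, k.+1%:R < norm2 y &
    [/\ norm2 w <= 2 * L, dot u v - k.+1%:R^-1 <= dot w v &
    regular_normal_cone (epi f) (row_mx y (f y)%:M) (row_mx w (-1)%:M)].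
  move=> k.
  have cuv : dot u v - k.+1%:R^-1 < dot u v by rewrite ltrBlDr ltrDl invr_gt0.
  have [x [t [xM t0 tM]]] := clarke_difference_quotient uC cuv (lt_trans ltr01 (M1 k)).
  have t1 : t <= 1.
    by rewrite ltW// (lt_le_trans tM)// invf_le1 ?(lt_trans ltr01)// ltW.
  have tv : t * norm2 v <= norm2 v by rewrite ler_piMl.
  have xr : r + 1 + t * norm2 v < norm2 x.
    by move: xM; rewrite /M; have := k1 k; lra.
  move=> /(mean_value_subgradient t0 xr)[y [w [yx wL cw nw]]].
  exists w, y; last by split.
  by move: xM yx tv v0 r0; rewrite /M; lra.
have [w' /= w'L w'cl] : exists2 p, norm2 p <= 2 * L & cluster (w @ \oo) p.
  have [|p [pL pcl]] := @compact_cball2 R n (2 * L) (w @ \oo) _.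
    by exists 0%N => // k _; rewrite /= /cball2/=; have [y _ []] := Hw k.
  by exists p.
(* Meeting a neighbourhood of the cluster point with such a tail yields an index where [w k] is
   close to [w'] and [k.+1] exceeds any prescribed threshold. *)
have tail (m : R) : (w @ \oo) [set w k | k in [set k | m < k.+1%:R]].
  exists (Num.truncn `|m|) => // k /= mk; exists k => //=.
  rewrite (le_lt_trans (ler_norm m))// (lt_le_trans (truncnS_gt _))// ler_nat.
  by rewrite ltnS.
exists w'; split=> //.
  apply/normal_cone_inftyP => e e0.
  have [_ [[k /= ke <-] kw]] := w'cl _ _ (tail e^-1) (near_norm2 w' e0).
  have [y yk [_ _ nw]] := Hw k.
  exists (row_mx y (f y)%:M), (row_mx (w k) (-1)%:M); split=> //.
  - by rewrite /epi/= row_mxKl row_mxKr mxE eqxx.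
  - by rewrite row_mxKl (lt_trans ke).
  - by rewrite opp_row_mx add_row_mx subrr norm2_row_mx norm2B.
rewrite leNgt; apply/negP => w'u.
pose e := (dot u v - dot w' v) / 2.
have e0 : 0 < e by rewrite divr_gt0// subr_gt0.
have near_w' : nbhs w' [set w | dot w v < dot w' v + e].
  apply: (cvgr_lt (dot w' v) (cvg_dot (@cvg_id _ (nbhs w')) (cvg_cst v))).
  by rewrite ltrDl.
have [_ [[k /= ke <-] kw]] := w'cl _ _ (tail e^-1) near_w'.
have [_ _ [_ uw _]] := Hw k.
have : k.+1%:R^-1 < e by rewrite invf_plt ?posrE.
by move: uw kw; rewrite /e /=; move: k.+1%:R^-1 (dot (w k) v) => a b; lra.
Qed.

Lemma compact_bounded_subdiff b :
  compact [set w | subdiff_infty f w /\ norm2 w <= b].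
Proof.
apply: (@subclosed_compact _ _ (@cball2 R n b)) => [||w []//].
  by apply: closedI; [exact: closed_subdiff_infty|exact: closed_cball2].
exact: compact_cball2.
Qed.

End LipschitzAtInfinity.

Unset Implicit Arguments.

Theorem proposition5p6 (R : realType) (n : nat) (f : 'rV[R]_n -> R)
    (f_lsc : lower_semicontinuous (EFin \o f))
    (f_lip : lipschitz_at_infinity f) :
  convex_hull (subdiff_infty f) = clarke_subdiff_infty f.
Proof.
apply/seteqP; split => [|u uC].
  apply: smallest_sub; first exact: convex_clarke_subdiff.
  by move=> u; exact: normal_cone_sub_clarke.
have [L [r [L0 r0 fL]]] := f_lip.
(* The support criterion needs a compact set, hence the bound [2 * L]; monotonicity of the hull then
   removes it. *)
have : convex_hull [set w | subdiff_infty f w /\ norm2 w <= 2 * L] u.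
  apply: support_convex_hull; first exact: compact_bounded_subdiff.
  move=> v; have [w [wf wL uw]] := subdiff_infty_directional L0 r0 fL v uC.
  by exists w.
by move=> uH C [cC fC]; apply: uH; split=> // w [wf _]; exact: fC.
Qed.
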